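(* For every $\epsilon>0$ there exists $\delta>0$ such that the following holds. Let $r\ge 2$ be an integer, and let $\Gamma$ be a $(d-1)$-dimensional simplicial complex with $n$ vertices such that $r/\log(n/d)<\delta$. (a) If $\mathrm{gr}_1(\Gamma)>2r$, then $f_1(\Gamma)\le (2^{-1}+\epsilon)(d-1)^{1-1/r}n^{1+1/r}$. (b) If $\mathrm{gr}_1(\Gamma)>2r+1$, then $f_1(\Gamma)\le (2^{-1-1/r}+\epsilon)(d-1)^{1-1/r}n^{1+1/r}$.
   Context: A simplicial complex $\Gamma$ on a finite vertex set $V=V(\Gamma)$ is a family of subsets of $V$ (faces) closed under taking subsets; its dimension is $\max\{|F|:F\in\Gamma\}-1$, and $f_i(\Gamma)$ denotes the number of faces with $i+1$ elements (so $f_1$ is the number of edges). For $W\subseteq V$, the induced subcomplex is $\Gamma[W]=\{F\in\Gamma:F\subseteq W\}$. For a face $F\in\Gamma$ (possibly $F=\emptyset$), the link is $\mathrm{lk}_\Gamma(F)=\{G\setminus F: F\subseteq G\in\Gamma\}$, with vertex set $V\setminus F$. Fix a field $\mathbf{k}$; $\tilde H_i(\cdot;\mathbf{k})$ denotes reduced simplicial homology. The $(p-1)$-girth is $\mathrm{gr}_{p-1}(\Gamma)=\min\{|W|: W\subseteq V(\Gamma),\ \tilde H_{p-1}(\mathrm{lk}_\Gamma(F)[W];\mathbf{k})\neq 0 \text{ for some face } F\in\Gamma \text{ (including } F=\emptyset)\}$, or $\infty$ if no such $W$ exists. Here $\log$ is the natural logarithm. *)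

(* Defs.v *)
From HB Require Import structures.
From mathcomp Require Import all_boot all_order all_algebra.
From Stdlib Require Import Reals.

Set Implicit Arguments.
Unset Strict Implicit.
Unset Printing Implicit Defensive.

Section Complexes.
Variable V : finType.

Definition is_complex (G : {set {set V}}) : Prop :=
  forall F H : {set V}, F \in G -> H \subset F -> H \in G.

Definition induced (G : {set {set V}}) (W : {set V}) : {set {set V}} :=
  [set H in G | H \subset W].

Definition link (G : {set {set V}}) (F : {set V}) : {set {set V}} :=
  [set H :\: F | H in [set H in G | F \subset H]].

Definition f1 (G : {set {set V}}) : nat := #|[set F in G | #|F| == 2]|.

Definition dimp1 (G : {set {set V}}) : nat := \max_(F in G) #|F|.

Local Open Scope ring_scope.

Variable k : fieldType.

Definition NV := #|{set V}|.

(* oriented boundary coefficient: rows = faces of K of size i+1,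
   columns = their codimension-one faces (size i); the sign is
   (-1)^(position of the removed vertex), vertices ordered by enum_rank. *)
Definition bd_coef (K : {set {set V}}) (i : nat) (Gf H : {set V}) : k :=
  if [&& Gf \in K, #|Gf| == i.+1, H \subset Gf & #|H| == i]
  then (-1) ^+ #|[set u in Gf | [exists w in Gf :\: H,
                                   ltn (enum_rank u) (enum_rank w)]]|
  else 0.

(* matrix of the (augmented) boundary map d_i : C_i -> C_{i-1}, acting on
   row vectors indexed by all subsets of V (zero outside the faces) *)
Definition bd (K : {set {set V}}) (i : nat) : 'M[k]_NV :=
  \matrix_(a < NV, b < NV) bd_coef K i (enum_val a) (enum_val b).

(* the chain space C_i : coordinate subspace of i-faces (size i+1) *)
Definition chains (K : {set {set V}}) (i : nat) : 'M[k]_NV :=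
  diag_mx (\row_(a < NV) if (enum_val a \in K) && (#|enum_val a| == i.+1)
                        then 1 else 0).

(* reduced homology \tilde H_i(K; k) is nonzero: Z_i is not contained in B_i *)
Definition hom_nz (K : {set {set V}}) (i : nat) : bool :=
  ~~ ((chains K i :&: kermx (bd K i)) <= bd K i.+1)%MS.

Definition girth_wit (G : {set {set V}}) (i : nat) (W : {set V}) : bool :=
  [exists F in G, hom_nz (induced (link G F) W) i].

(* gr_i(G) as an element of nat + {infinity} (None = infinity) *)
Definition girth (G : {set {set V}}) (i : nat) : option nat :=
  if [exists W, girth_wit G i W]
  then Some (\big[minn/#|V|.+1]_(W | girth_wit G i W) #|W|)
  else None.

Definition girth_gt (G : {set {set V}}) (i m : nat) : Prop :=
  match girth G i with None => True | Some g => ltn m g end.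

End Complexes.

(* x^y for x >= 0 real, with 0^y = 0 (used only for y > 0);
   Stdlib's Rpower 0 y is 1, hence this guard. *)
Definition rpow (x y : R) : R :=
  if Req_EM_T x 0 then 0%R else Rpower x y.

(* Main.v *)
(** The hypothesis on links forces the complex to be the clique complex of its
    graph (a minimal non-face would leave an empty triangle in a link), and the
    graph to have no induced cycle of length between 4 and the girth bound: a
    closed walk u, x, ..., y, u with x, y not adjacent and the remaining vertices
    not adjacent to u is a 1-cycle that cannot bound.

    Call a walk good if v_(i+1) is neither equal nor adjacent to v_(i-1). Short
    good walks are induced paths, and the possible second vertices of good walks
    of length at most r from u to v form, together with u, a clique. So there are
    at most (d-1)^(r-1) good walks of length r from u to v, and at most
    n (d-1)^(r-1) from u after a prescribed edge. When the girth exceeds 2r+1,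
    the walks leaving an edge at its two ends have distinct endpoints, which
    saves a factor 2.

    Conversely, as in the Alon-Hoory-Linial proof of the Moore bound for
    irregular graphs, the mean of ln (number of good walks) over directed edges
    grows by about ln (average degree) with each step. The continuations of
    x -> y are the neighbours of y outside N[x]. After a small proportion of the
    edges is deleted they are nearly all neighbours of y: in N(y) only few
    vertices have many neighbours, since a large independent set of such
    vertices is excluded by counting common neighbours. The remaining defect is
    absorbed by an almost doubly stochastic transition matrix. *)
Require Import Defs.
From Stdlib Require Import Reals.
From HB Require Import structures.
From mathcomp Require Import all_boot all_order all_algebra.
From mathcomp Require Import zify ring lra.
From mathcomp Require Import reals Rstruct.
Set Implicit Arguments.
Unset Strict Implicit.
Unset Printing Implicit Defensive.
Import Order.TTheory GRing.Theory Num.Theory.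

(** * Closed walks as 1-cycles, and a criterion for nonzero first homology *)

Section Homology.
Variables (V : finType) (k : fieldType) (K : {set {set V}}).
Local Open Scope ring_scope.

Definition face_vec (F : {set V}) : 'rV[k]_(NV V) := delta_mx 0 (enum_rank F).

(** Orients the basis vector of an unordered pair from [a] to [b]: its boundary becomes head minus
    tail whichever vertex is enumerated first. *)
Definition edge_sign (a b : V) : k :=
  if (enum_rank a < enum_rank b)%N then 1 else -1.

Definition edge_vec (a b : V) : 'rV[k]_(NV V) :=
  edge_sign a b *: face_vec [set a; b].

Fixpoint walk_vec (a : V) (s : seq V) : 'rV[k]_(NV V) :=
  if s is b :: s' then edge_vec a b + walk_vec b s' else 0.

Definition is_edge (a b : V) : bool := (a != b) && ([set a; b] \in K).

Lemma bd_coef_edge (a b u : V) : is_edge a b ->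
  bd_coef k K 1 [set a; b] [set u] =
    edge_sign a b * ((u == b)%:R - (u == a)%:R).
Proof.
case/andP=> ab abK; rewrite /bd_coef abK cards2 ab cards1 eqxx /= andbT sub1set.
have ba: b == a = false by rewrite eq_sym; apply/negbTE.
have card_below (x y : V) : x != y -> [set x; y] = [set a; b] ->
  #|[set v in [set a; b] | [exists w in [set a; b] :\ x,
       (enum_rank v < enum_rank w)%N]]| = (enum_rank x < enum_rank y)%N.
  move=> xy <-.
  have ->: [set x; y] :\ x = [set y].
    by apply/setP=> z; rewrite !inE; case: (eqVneq z x) => // ->; rewrite (negbTE xy).
  have ex v : [exists w in [set y], (enum_rank v < enum_rank w)%N]
      = (enum_rank v < enum_rank y)%N.
    apply/existsP/idP => [[w]|h]; first by rewrite inE => /andP[/eqP->].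
    by exists y; rewrite inE eqxx.
  have -> : [set v in [set x; y] | [exists w in [set y], (enum_rank v < enum_rank w)%N]]
     = if (enum_rank x < enum_rank y)%N then [set x] else set0.
    apply/setP=> v; rewrite !inE ex.
    case: (eqVneq v x) => [->|vx] /=.
      by case: ifP => //; rewrite !inE ?eqxx.
    case: (eqVneq v y) => [->|vy] /=; first by rewrite ltnn; case: ifP; rewrite !inE // eq_sym (negbTE xy).
    by case: ifP; rewrite !inE ?(negbTE vx).
  by case: ifP; rewrite ?cards1 ?cards0.
rewrite !inE.
case: (eqVneq u a) => [->|ua] /=.
  rewrite (negbTE ab) (card_below a b) // /edge_sign.
  by case: ifP => _ /=; rewrite ?expr1 ?expr0 sub0r ?mul1r // mulrN1 opprK.
case: (eqVneq u b) => [->|ub] /=; last by rewrite subrr mulr0.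
rewrite (card_below b a) ?(setUC [set b]) 1?eq_sym // subr0 mulr1 /edge_sign.
case: ltngtP => //= /ord_inj /enum_rank_inj h.
by rewrite h eqxx in ab.
Qed.

Lemma edge_vec_bd (a b : V) : is_edge a b ->
  edge_vec a b *m bd k K 1 = face_vec [set b] - face_vec [set a].
Proof.
move=> e; apply/rowP=> j; rewrite -(enum_valK j); move: (enum_val j) => H.
rewrite /edge_vec -scalemxAl /face_vec -rowE.
rewrite !mxE !enum_rankK !eqxx /= !(inj_eq enum_rank_inj).
have [cH|cH] := boolP (#|H| == 1)%N.
  case/cards1P: cH => u ->; rewrite bd_coef_edge // mulrA.
  rewrite !(inj_eq set1_inj) /edge_sign.
  by case: ifP => _; rewrite ?mulrNN ?mulr1 mul1r.
have H1 v : H == [set v] = false by apply/eqP=> h; rewrite h cards1 in cH.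
by rewrite !H1 subrr /bd_coef (negbTE cH) !andbF mulr0.
Qed.

Lemma walk_vec_bd (a : V) (s : seq V) : path is_edge a s ->
  walk_vec a s *m bd k K 1 = face_vec [set last a s] - face_vec [set a].
Proof.
elim: s a => [|b s IH] a /=; first by rewrite mul0mx subrr.
by case/andP=> ab /IH h; rewrite mulmxDl h edge_vec_bd // addrC subrKA.
Qed.

(** [chains] is a diagonal projection, so a vector fixed by it lies in its row space. *)
Lemma edge_vec_chain (a b : V) : is_edge a b ->
  edge_vec a b *m chains k K 1 = edge_vec a b.
Proof.
case/andP=> ab abK; rewrite /edge_vec -scalemxAl /face_vec -rowE; congr (_ *: _).
apply/rowP=> j; rewrite !mxE eqxx /= enum_rankK abK cards2 ab eqxx /=.
by rewrite eq_sym; case: eqP => //= _; rewrite mulr0n.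
Qed.

Lemma walk_vec_chain (a : V) (s : seq V) : path is_edge a s ->
  walk_vec a s *m chains k K 1 = walk_vec a s.
Proof.
elim: s a => [|b s IH] a /=; first by rewrite mul0mx.
by case/andP=> ab /IH h; rewrite mulmxDl h edge_vec_chain.
Qed.

Lemma walk_vec_coef (u x a : V) (s : seq V) : u \notin a :: s ->
  walk_vec a s 0 (enum_rank [set u; x]) = 0.
Proof.
elim: s a => [|b s IH] a /=; first by rewrite mxE.
rewrite !inE !negb_or => /and3P[ua ub us].
rewrite mxE IH ?inE ?negb_or ?ub // addr0 !mxE eqxx (inj_eq enum_rank_inj) /=.
case: eqP => [/setP/(_ u)|]; last by rewrite mulr0.
by rewrite !inE eqxx (negbTE ua) (negbTE ub).
Qed.

(* The closed walk u, x, ..., y, u is a 1-cycle; it uses the edge {u, x} once,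
   while boundaries have coefficient 0 there. *)
Lemma hom1_nz (u x : V) (s : seq V) :
  path is_edge u (x :: s) -> is_edge (last x s) u -> x != last x s ->
  u \notin x :: s ->
  (forall T, T \in K -> #|T| = 3 -> ~~ ([set u; x] \subset T)) ->
  hom_nz k K 1.
Proof.
move=> pw pl xl us free; set y := last x s in pl xl.
pose z := walk_vec u (x :: rcons s u).
have pz: path is_edge u (x :: rcons s u).
  by move: pw => /= /andP[-> p]; rewrite rcons_path p.
have ux : u != x by move: pw => /= /andP[/andP[]].
apply/negP=> sub.
have: (z <= bd k K 2)%MS.
  apply: submx_trans sub; rewrite sub_capmx; apply/andP; split.
    by rewrite -[z](walk_vec_chain pz) submxMl.
  apply/sub_kermxP; rewrite walk_vec_bd //=.
  by rewrite last_rcons subrr.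
case/submxP=> D /rowP/(_ (enum_rank [set u; x])) /eqP; apply/negP.
(* A nonzero term would come from a face of size 3 containing {u, x}, which [free] excludes. *)
rewrite [X in _ != X]mxE big1 => [|i _]; last first.
  rewrite mxE enum_rankK /bd_coef.
  case: ifP => [/and4P[TK /eqP cT sT _]|]; last by rewrite mulr0.
  by move: (free _ TK cT); rewrite sT.
have walk_rcons a t c : walk_vec a (rcons t c) = walk_vec a t + edge_vec (last a t) c.
  by elim: t a => [|b t IH] a /=; rewrite ?addr0 ?add0r // IH addrA.
rewrite /z /= walk_rcons !mxE walk_vec_coef // eqxx /= eqxx add0r.
have -> : (enum_rank [set u; x] == enum_rank [set y; u]) = false.
  rewrite (inj_eq enum_rank_inj); apply/eqP=> /setP/(_ x).
  by rewrite !inE eqxx orbT (negbTE xl) eq_sym (negbTE ux).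
rewrite mulr0 addr0 mulr1 /edge_sign.
by case: ifP => _; rewrite ?oppr_eq0 oner_eq0.
Qed.

End Homology.

(** * Consequences of the girth bound: short cycles are excluded and cliques are faces *)

Section Girth.
Variables (V : finType) (k : fieldType) (G : {set {set V}}) (m : nat).
Hypotheses (Gc : is_complex G) (Gm : girth_gt k G 1 m).

Lemma girth_gt_hom (F W : {set V}) : F \in G -> #|W| <= m ->
  ~~ hom_nz k (induced (link G F) W) 1.
Proof.
move=> FG Wm; apply/negP=> hW; move: Gm; rewrite /girth_gt /girth.
have wW : girth_wit k G 1 W by apply/existsP; exists F; rewrite FG.
case: ifP => [_|/existsP[]]; last by exists W.
apply/negP; rewrite -leqNgt; apply: leq_trans Wm.
elim: (index_enum _) (mem_index_enum W) => // W' e IH.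
rewrite inE big_cons => /predU1P[<-|/IH le]; first by rewrite wW geq_minl.
by case: ifP => // _; apply: leq_trans (geq_minr _ _) le.
Qed.

Lemma mem_link (F H : {set V}) :
  (H \in link G F) = [disjoint H & F] && (H :|: F \in G).
Proof.
apply/imsetP/andP=> [[H']|[dHF HFG]].
  rewrite inE => /andP[H'G FH'] ->; split.
    by rewrite -setI_eq0 setIDAC -setIDA setDv setI0.
  suff -> : H' :\: F :|: F = H' by [].
  by apply/setP=> v; rewrite !inE; case: (boolP (v \in F)) => [/(subsetP FH')->|]; rewrite ?orbF.
exists (H :|: F); first by rewrite inE HFG subsetUr.
by rewrite setDUl setDv setU0; apply/esym/setDidPl.
Qed.

Lemma complex_edgeC (K : {set {set V}}) : symmetric (is_edge K).
Proof. by move=> a b; rewrite /is_edge eq_sym setUC. Qed.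

(** Take the link of the empty face, restricted to the vertices of the walk. A triangle on {u, x}
    would need a third vertex adjacent to [u]; only the last vertex qualifies, and it is not
    adjacent to [x]. Vertices may repeat, so the walk need not be an induced cycle. *)
Lemma no_short_cycle (u x : V) (s : seq V) :
  is_edge G u x -> is_edge G u (last x s) -> x != last x s ->
  ~~ is_edge G x (last x s) -> path (is_edge G) x s ->
  (forall v, v \in x :: s -> [|| v == x, v == last x s |
      (v != u) && ~~ is_edge G u v]) ->
  m < size s + 2.
Proof.
set y := last x s => ux uy xy nxy p far; rewrite ltnNge; apply/negP => small.
pose W := [set v in u :: x :: s].
have G0 : set0 \in G by case/andP: ux => _ /Gc; apply; rewrite sub0set.
have Wm : #|W| <= m.
  rewrite cardsE; apply: leq_trans (card_size _) _.
  by move: small => /=; rewrite addn2.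
apply: (negP (girth_gt_hom G0 Wm)).
have memK H : (H \in induced (link G set0) W) = (H \in G) && (H \subset W).
  by rewrite inE mem_link disjoints_subset setC0 subsetT setU0.
have eK a b : a \in W -> b \in W -> is_edge G a b -> is_edge (induced (link G set0) W) a b.
  move=> aW bW /andP[ab abG]; rewrite /is_edge ab memK abG subUset !sub1set.
  by rewrite aW.
have mono (t : seq V) a : {subset a :: t <= W} -> path (is_edge G) a t ->
    path (is_edge (induced (link G set0) W)) a t.
  elim: t a => [|b t IH] a //= sub /andP[ab pb]; rewrite eK ?sub ?inE ?eqxx ?orbT //=.
  by apply: IH => // v vt; apply: sub; rewrite inE vt orbT.
apply: (@hom1_nz _ _ _ u x s) => //.
- by apply: mono; [move=> v h; rewrite inE | rewrite /= ux].
- apply: eK; rewrite ?inE ?eqxx //; first by rewrite -in_cons mem_last orbT.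
  by rewrite complex_edgeC.
- apply/negP=> /far; rewrite eqxx /=.
  by case/andP: ux => /negPf-> _; case/andP: uy => /negPf->.
move=> T; rewrite memK => /andP[TG TW] T3; apply/negP=> uxT.
have : T :\: [set u; x] != set0.
  rewrite -card_gt0 cardsD (setIidPr uxT) cards2 T3.
  by case: (u != x).
case/set0Pn=> v; rewrite !inE negb_or => /andP[/andP[vu vx] vT].
have e a b : a \in T -> b \in T -> a != b -> is_edge G a b.
  by move=> aT bT ab; rewrite /is_edge ab /=; apply: Gc TG _; rewrite subUset !sub1set aT.
have uT : u \in T by apply: (subsetP uxT); rewrite !inE eqxx.
have xT : x \in T by apply: (subsetP uxT); rewrite !inE eqxx orbT.
have := subsetP TW _ vT; rewrite inE inE (negbTE vu) /= => /far.
have uv : u != v by rewrite eq_sym.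
have xv : x != v by rewrite eq_sym.
rewrite (negbTE vx) vu (e u v) //= orbF => /eqP vy.
by move: nxy; rewrite -vy e.
Qed.

(** By induction every proper subset of [C] is a face. If [C] were not, any three of its vertices
    would span an empty triangle in the link of the remaining ones. *)
Lemma clique_face (C : {set V}) : 3 <= m -> 2 <= #|C| ->
  (forall a b, a \in C -> b \in C -> a != b -> is_edge G a b) -> C \in G.
Proof.
move=> m3; have [n] := ubnP #|C|; elim: n C => // n IH C /ltnSE Cn C2 cl.
move: C2; rewrite leq_eqVlt => /orP[/eqP/esym/eqP/cards2P[a [b [ab E]]]|].
  have: is_edge G a b by apply: cl; rewrite // E !inE eqxx ?orbT.
  by rewrite E => /andP[].
case/card_gt2P=> a [b [c [[aC bC cC] [ab bc ca]]]].
apply: contraT => CnG.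
have sub (H : {set V}) v : v \in C -> H \subset C -> v \notin H -> H \in G.
  move=> vC HC vH; apply: (Gc (F := C :\ v)); last first.
    by rewrite subsetD1 HC.
  have Cv := cardsD1 v C; rewrite vC in Cv.
  have C3 : 2 < #|C| by apply/card_gt2P; exists a, b, c.
  apply: IH; [by move: Cv Cn; lia | by move: Cv C3; lia |].
  by move=> x y /setD1P[_ xC] /setD1P[_ yC]; apply: cl.
pose W := [set a; b; c]; pose F := C :\: W.
have FG : F \in G by apply: (sub _ a) => //; rewrite ?subsetDl // !inE eqxx.
have W3 : #|W| = 3.
  by rewrite /W setUC cardsU1 cards2 !inE negb_or ca ab (eq_sym c) bc.
have Wm : #|W| <= m by rewrite W3.
case/negP: (girth_gt_hom FG Wm).
have WC : W \subset C by rewrite !subUset !sub1set aC bC.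
have eK x y z : z \in W -> x \in W -> y \in W -> x != y -> z != x -> z != y ->
    is_edge (induced (link G F) W) x y.
  move=> zW xW yW xy zx zy; rewrite /is_edge xy inE mem_link subUset !sub1set xW yW !andbT /=.
  apply/andP; split.
    by rewrite disjoints_subset subUset !sub1set !in_setC !in_setD xW yW.
  apply: (sub _ z).
  - exact: (subsetP WC).
  - by rewrite !subUset !sub1set subsetDl !(subsetP WC).
  - by rewrite in_setU in_set2 (negbTE zx) (negbTE zy) in_setD zW.
have [aW bW cW] : [/\ a \in W, b \in W & c \in W] by rewrite !inE !eqxx !orbT.
apply: (@hom1_nz _ _ _ a b [:: c]) => /=.
- by rewrite (eK a b c) ?(eK b c a) // 1?eq_sym // eq_sym.
- by rewrite (eK c a b) // eq_sym.
- exact: bc.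
- by rewrite !inE negb_or ab eq_sym.
move=> T; rewrite inE mem_link => /andP[/andP[_ TF] TW] T3.
suff TWe : T = W.
  by case/negP: CnG; rewrite -(setID C W) (setIidPr WC) -{1}TWe.
by apply/eqP; rewrite eqEcard TW T3 W3.
Qed.
End Girth.

(** * Good walks and upper bounds for their number *)

Section GoodWalks.
Variables (T : finType) (adj : rel T) (m d : nat).
Hypotheses (adjC : symmetric adj) (adjI : irreflexive adj).

Definition fwd (u v : T) : bool := (v != u) && ~~ adj u v.

Definition no_short_induced_cycle : Prop := forall (u x : T) (s : seq T),
  adj u x -> adj u (last x s) -> x != last x s -> ~~ adj x (last x s) ->
  path adj x s ->
  (forall v, v \in x :: s -> [|| v == x, v == last x s | fwd u v]) ->
  m < size s + 2.

Definition clique_le : Prop := forall C : {set T},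
  (forall a b, a \in C -> b \in C -> a != b -> adj a b) -> #|C| <= d.

Hypotheses (Hcyc : no_short_induced_cycle) (Hcl : clique_le).

Lemma fwdC : symmetric fwd.
Proof. by move=> u v; rewrite /fwd eq_sym adjC. Qed.

Variable e : rel T.
Hypotheses (eC : symmetric e) (eadj : subrel e adj).

(** Steps follow a subgraph [e], but non-adjacency is tested in the full graph [adj], so the cycle
    hypothesis still applies after edges are deleted. *)
Fixpoint good (y z : T) (s : seq T) : bool :=
  if s is t :: s' then [&& e z t, fwd y t & good z t s'] else true.

Lemma good_path (y z : T) (s : seq T) : good y z s -> path adj z s.
Proof.
by elim: s y z => [|t s IH] y z //= /and3P[/eadj-> _ /IH].
Qed.

(** By induction the later vertices are forward from [z]. Let v be the first vertex not forward from
    [y]. If v = y, its predecessor, forward from [y], would be adjacent to it; if v is adjacent to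
    [y], the walk from [z] to v closes up at [y] to a short cycle. *)
Lemma good_fwd (y z : T) (s : seq T) : adj y z -> good y z s ->
  size s + 2 <= m -> all (fwd y) s.
Proof.
elim: s y z => [|t s IH] y z yz //= /and3P[zt yt gs] sm; rewrite yt /=.
have /allP zs : all (fwd z) s by apply: IH gs _; [exact: eadj | lia].
apply: contraT; rewrite -has_predC => /split_find E.
have ps := good_path gs.
case: E ps zs sm => v s1 s2 /negbTE nv.
rewrite has_predC negbK => /allP s1y ps zs sm.
have /andP[p1 _] : path adj t (rcons s1 v) && path adj (last t (rcons s1 v)) s2.
  by rewrite -cat_path.
have vz : fwd z v by apply: zs; rewrite mem_cat mem_rcons inE eqxx.
move: (nv); rewrite /= /fwd; case: eqVneq => [vy|vy] /= => [_|/negbFE yv].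
  have : fwd y (last t s1).
    have := mem_last t s1; rewrite inE => /orP[/eqP->//|]; exact: s1y.
  move: p1; rewrite rcons_path -vy => /andP[_ h].
  by rewrite /fwd adjC h andbF.
have := @Hcyc y z (t :: rcons s1 v) yz.
rewrite /= last_rcons => /(_ yv); rewrite eq_sym; move: (vz) => /andP[-> ->].
move=> /(_ isT isT); rewrite eadj // => /(_ p1) h.
have : m < (size (rcons s1 v)).+1 + 2.
  apply: h => w; rewrite !inE mem_rcons inE => /or4P[->//|/eqP->|->|/s1y->]; rewrite ?yt ?orbT //.
by move: sm; rewrite size_cat !size_rcons; lia.
Qed.

(* Two good walks from the neighbours z, z' of y that end at the same vertex
   close up to a cycle through z, y, z'. *)
Lemma good_meet (y z z' : T) (s s' : seq T) :
  adj y z -> adj y z' -> z != z' -> ~~ adj z z' ->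
  path adj z s -> path adj z' s' -> last z s = last z' s' ->
  all (fwd y) s -> all (fwd y) s' -> m < size s + size s' + 2.
Proof.
move=> yz yz' zz' nzz' p p' E /allP a /allP a'.
pose w := s ++ rev (belast z' s').
have lw : last z w = z'.
  rewrite /w last_cat E; case: s' {a' p' w} E => [|t s'] //= E.
  by rewrite rev_cons last_rcons.
have sw : size w = size s + size s' by rewrite size_cat size_rev size_belast.
rewrite -sw; apply: (@Hcyc y z); rewrite ?lw //.
  rewrite cat_path p E /= rev_path.
  by under eq_path => u v do rewrite /= adjC.
move=> v; rewrite inE mem_cat mem_rev => /or3P[->//|/a->|]; rewrite ?orbT //.
by move/mem_belast; rewrite inE => /orP[->|/a'->]; rewrite !orbT.
Qed.

Fixpoint nwalk_to (k : nat) (x y v : T) : nat :=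
  if k is k'.+1 then \sum_(z | e y z && fwd x z) nwalk_to k' y z v
  else (y == v).

Fixpoint nwalk (k : nat) (x y : T) : nat :=
  if k is k'.+1 then \sum_(z | e y z && fwd x z) nwalk k' y z else 1.

Lemma nwalkE k x y : nwalk k x y = \sum_v nwalk_to k x y v.
Proof.
elim: k x y => [|k IH] x y /=.
  by rewrite (bigD1 y) //= eqxx big1 // => v /negbTE; rewrite eq_sym => ->.
by rewrite exchange_big; apply: eq_bigr => z _.
Qed.

Lemma nwalk_to_good k x y v : 0 < nwalk_to k x y v ->
  exists s, [/\ good x y s, size s = k & last y s = v].
Proof.
elim: k x y => [|k IH] x y /=; first by rewrite lt0b => /eqP<-; exists [::].
rewrite lt0n sum_nat_eq0 negb_forall => /existsP[z].
rewrite negb_imply => /andP[/andP[yz xz]]; rewrite -lt0n => /IH[s [g sz l]].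
by exists (z :: s); rewrite /= yz xz g sz l.
Qed.

(** The possible next vertices form a clique together with [y]: by [good_meet], two non-adjacent
    ones would yield too short a cycle. So each step has at most d - 1 choices, and the last one is
    determined by [v]. *)
Lemma nwalk_to_le k x y v : adj x y -> 2 * k.+1 <= m ->
  nwalk_to k.+1 x y v <= d.-1 ^ k.
Proof.
elim: k x y => [|k IH] x y xy km.
  rewrite /= expn0; case: (boolP (e y v && fwd x v)) => h.
    by rewrite (bigD1 v) //= eqxx big1 ?addn0 // => z /andP[_ /negbTE->].
  by rewrite big1 // => z hz; case: eqP => // zv; rewrite zv (negbTE h) in hz.
pose Z := [set z | e y z && fwd x z & 0 < nwalk_to k.+1 y z v].
have Zy z : z \in Z -> adj y z by rewrite inE => /andP[/andP[/eadj]].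
have Zcl : #|y |: Z| <= d.
  apply: Hcl => a b; rewrite !in_setU1.
  move=> /orP[/eqP->|aZ] /orP[/eqP->|bZ] ab.
  - by rewrite eqxx in ab.
  - exact: Zy.
  - by rewrite adjC; apply: Zy.
  move: (aZ) (bZ); rewrite !inE => /andP[_ /nwalk_to_good[s [gs ss ls]]].
  move=> /andP[_ /nwalk_to_good[s' [gs' ss' ls']]].
  apply: contraT => nab.
  suff : m < size s + size s' + 2 by rewrite ss ss'; lia.
  apply: (@good_meet y a b); rewrite ?Zy ?(good_path gs) ?(good_path gs') ?ls' //.
    by apply: good_fwd gs _; rewrite ?Zy // ss; lia.
  by apply: good_fwd gs' _; rewrite ?Zy // ss'; lia.
have yZ : y \notin Z by apply/negP=> /Zy; rewrite adjI.
have {Zcl yZ}Zd : #|Z| <= d.-1 by move: Zcl; rewrite cardsU1 yZ; lia.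
change (\sum_(z | e y z && fwd x z) nwalk_to k.+1 y z v <= d.-1 ^ k.+1).
rewrite (bigID (mem Z)) /= [X in _ + X]big1 ?addn0; last first.
  by move=> z; rewrite inE => /andP[->] /=; rewrite -leqNgt leqn0 => /eqP.
rewrite expnS; apply: (@leq_trans (\sum_(z in Z) d.-1 ^ k)).
  rewrite (eq_bigl (mem Z)) => [|z]; last by rewrite !inE; case: (e y z && fwd x z).
  by apply: leq_sum => z /Zy yz; apply: IH => //; lia.
by rewrite sum_nat_const leq_mul2r Zd orbT.
Qed.

Lemma nwalk_le k x y : adj x y -> 2 * k.+1 <= m ->
  nwalk k.+1 x y <= #|T| * d.-1 ^ k.
Proof.
move=> xy km; rewrite nwalkE; apply: (@leq_trans (\sum_(v : T) d.-1 ^ k)).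
  by apply: leq_sum => v _; apply: nwalk_to_le.
by rewrite sum_nat_const.
Qed.

(** For each endpoint at most one of the two counts is nonzero: walks leaving the edge at both ends
    and meeting again would close up to a cycle of length 2k + 3. *)
Lemma nwalk_add_le k x y : adj x y -> 2 * k.+1 + 1 <= m ->
  nwalk k.+1 x y + nwalk k.+1 y x <= #|T| * d.-1 ^ k.
Proof.
move=> xy km; rewrite !nwalkE -big_split.
apply: (@leq_trans (\sum_(v : T) d.-1 ^ k)); last by rewrite sum_nat_const.
apply: leq_sum => v _.
change (nwalk_to k.+1 x y v + nwalk_to k.+1 y x v <= d.-1 ^ k).
have yx : adj y x by rewrite adjC.
have h1 : nwalk_to k.+1 x y v <= d.-1 ^ k by apply: nwalk_to_le => //; lia.
have h2 : nwalk_to k.+1 y x v <= d.-1 ^ k by apply: nwalk_to_le => //; lia.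
case: (posnP (nwalk_to k.+1 x y v)) => [-> //|/nwalk_to_good[s [gs ss ls]]].
case: (posnP (nwalk_to k.+1 y x v)) => [->|]; first by rewrite addn0.
case/nwalk_to_good=> -[|u s'] [//= /and3P[/eadj xu yu gs'] [ss'] ls'].
move: yu; rewrite /fwd => /andP[uy yu].
suff : m < size s + size s' + 2 by rewrite ss ss'; lia.
apply: (@good_meet x y u) => //; rewrite ?(good_path gs) ?(good_path gs') ?ls' //.
- by rewrite eq_sym.
- apply: good_fwd gs _ => //; rewrite ss; lia.
- apply: good_fwd gs' _ => //; rewrite ss'; lia.
Qed.

End GoodWalks.

(** * Deleting few edges so that most neighbours continue a good walk *)

Section BadNeighbours.
Variables (T : finType) (adj : rel T) (m d : nat).
Hypotheses (adjC : symmetric adj) (adjI : irreflexive adj).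
Hypotheses (Hcyc : no_short_induced_cycle adj m) (Hcl : clique_le adj d).
Hypothesis m4 : 4 <= m.

Definition nbrs (e : rel T) (y : T) : {set T} := [set z | e y z].

(** Two non-adjacent common neighbours would form an induced 4-cycle with [i] and [j], so the common
    neighbours form a clique. *)
Lemma card_common_nbrs (i j : T) : i != j -> ~~ adj i j ->
  #|[set z | adj i z && adj j z]| <= d.
Proof.
move=> ij nij; apply: Hcl => a b; rewrite !inE => /andP[ia ja] /andP[ib jb] ab.
apply: contraT => nab.
have := @Hcyc i a [:: j; b]; rewrite /= ia ib ab nab jb (adjC a j) ja.
move=> /(_ isT isT isT isT isT) h; suff : m < 4 by lia.
apply: h => v; rewrite !inE /fwd => /or3P[->|/eqP->|->]; rewrite ?orbT //.
by rewrite (eq_sym j i) ij nij !orbT.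
Qed.

Definition indep (I : {set T}) : bool :=
  [forall a in I, forall b in I, ~~ adj a b].

Lemma indepP (I : {set T}) :
  reflect (forall a b, a \in I -> b \in I -> ~~ adj a b) (indep I).
Proof.
apply: (iffP forall_inP) => [h a b aI bI|h a aI].
  by have /forall_inP := h _ aI; apply.
by apply/forall_inP => b; apply: h.
Qed.

(* Each vertex of B is either tied to exactly one vertex i of a maximum
   independent set (such vertices form a clique, by maximality), or it is a
   common neighbour of two of its vertices. *)
Lemma card_le_indep (B : {set T}) : exists I : {set T},
  [/\ indep I, I \subset B & #|B| <= #|I| ^ 2 * d].
Proof.
have P0 : indep set0 && (set0 \subset B).
  by rewrite sub0set andbT; apply/indepP=> a b; rewrite inE.
case: (@arg_maxnP _ set0 (fun I => indep I && (I \subset B)) (fun I : {set T} => #|I|) P0) => I /andP[iI IB] Imax.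
exists I; split=> //.
pose tied v := [set i in I | ~~ fwd adj i v].
pose C (q : T * T) := if q.1 == q.2 then [set v in B | tied v == [set q.1]]
   else [set z | adj q.1 z && adj q.2 z].
have nfwd i v : ~~ fwd adj i v = (v == i) || adj i v.
  by rewrite /fwd negb_and !negbK.
have cover : B \subset \bigcup_(q in setX I I) C q.
  apply/subsetP=> v vB; apply/bigcupP.
  case: (set_0Vmem (tied v)) => [t0|[i it]].
    have := Imax (v |: I); rewrite cardsU1.
    have vI : v \notin I.
      apply/negP=> vI; have : v \in tied v by rewrite inE vI nfwd eqxx.
      by rewrite t0 inE.
    have nvI a : a \in I -> ~~ adj a v.
      move=> aI; apply/negP=> av; have : a \in tied v by rewrite inE aI nfwd av orbT.
      by rewrite t0 inE.
    rewrite vI /= => h; exfalso; suff : 1 + #|I| <= #|I| by rewrite add1n ltnn.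
    apply: h; rewrite subUset sub1set vB IB !andbT; apply/indepP=> a b.
    rewrite !in_setU1 => /orP[/eqP->|aI] /orP[/eqP->|bI]; rewrite ?adjI ?nvI //.
      by rewrite adjC nvI.
    exact: (indepP _ iI).
  have iI' : i \in I by move: it; rewrite inE => /andP[].
  case: (boolP (tied v == [set i])) => [t1|].
    by exists (i, i); rewrite ?inE /= ?iI' // /C eqxx inE vB t1.
  rewrite eqEsubset sub1set it andbT => /subsetPn[j jt]; rewrite inE => ji.
  have jI : j \in I by move: jt; rewrite inE => /andP[].
  have nij : ~~ adj i j by apply: (indepP _ iI).
  exists (i, j); rewrite ?inE /= ?iI' // /C /= eq_sym (negbTE ji) inE.
  move: it jt; rewrite !inE !nfwd => /andP[_ iv] /andP[_ jv].
  case/orP: iv => [/eqP vi|iv]; case/orP: jv => [/eqP vj|jv].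
  - by rewrite -vi vj eqxx in ji.
  - by rewrite adjC -vi jv in nij.
  - by rewrite vj (negbTE nij) in iv.
  - by rewrite iv jv.
have Cd q : q \in setX I I -> #|C q| <= d.
  case: q => i j; rewrite inE /= => /andP[iI' jI]; rewrite /C /=.
  case: eqVneq => [_|ij]; last by apply: card_common_nbrs => //; apply: (indepP _ iI).
  apply: Hcl => a b; rewrite !inE => /andP[aB /eqP ta] /andP[bB /eqP tb] ab.
  apply: contraT => nab.
  have tiedD c w : tied c = [set i] -> w \in I -> w != i -> fwd adj w c.
    move=> tc wI wi; apply: contraR wi => wc.
    by rewrite -in_set1 -tc inE wI.
  have notI c : tied c = [set i] -> c \notin I :\ i.
    move=> tc; rewrite !inE negb_and; apply/orP.
    case: (eqVneq c i) => /= ci; [by left | right]; apply/negP=> cI.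
    by have := tiedD c c tc cI ci; rewrite /fwd eqxx.
  (* Exchange: non-adjacent [a] and [b] tied to [i] alone could replace [i] in the maximum set. *)
  have := Imax (a |: (b |: I :\ i)).
  have aN : a \notin b |: I :\ i by rewrite in_setU1 negb_or ab notI.
  rewrite !cardsU1 aN (notI b tb).
  have /= := cardsD1 i I; rewrite iI' => EI h; suff: 1 + (1 + #|I :\ i|) <= #|I| by rewrite EI add1n ltnn.
  apply: h; rewrite !subUset !sub1set aB bB (subset_trans _ IB) ?subsetDl // !andbT.
  have tD w c : tied c = [set i] -> w \in I :\ i -> ~~ adj w c.
    by move=> tc /setD1P[wi wI]; have /andP[] := tiedD _ _ tc wI wi.
  apply/indepP=> u v; rewrite !in_setU1.
  move=> /or3P[/eqP->|/eqP->|uI] /or3P[/eqP->|/eqP->|vI]; rewrite ?adjI //.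
  - by rewrite adjC tD.
  - by rewrite adjC.
  - by rewrite adjC tD.
  - exact: tD.
  - exact: tD.
  by apply: (indepP _ iI); [case/setD1P: uI | case/setD1P: vI].
apply: leq_trans (subset_leq_card cover) _.
have /leq_trans: #|\bigcup_(q in setX I I) C q| <= \sum_(q in setX I I) #|C q|.
  by elim/big_rec2: _ => [|q s S _ le]; rewrite ?cards0 // (leq_trans (leq_card_setU _ _)) ?leq_add2l.
apply; apply: (@leq_trans (\sum_(q in setX I I) d)); first exact: leq_sum.
by rewrite sum_nat_const cardsX mulnn.
Qed.

Variable p : nat.
Hypothesis p0 : 0 < p.

Definition bad (x y : T) : bool :=
  #|nbrs adj y| < #|[set z in nbrs adj y | ~~ fwd adj x z]| * p.

(** Second moments for 2p members of [I]: let T(z) count those equal or adjacent to z, for z in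
    N(y). Badness forces the sum of T above 2|N(y)|, while distinct members share at most [d]
    neighbours, which bounds the sum of T^2. *)
Lemma indep_bad_lt (y : T) (I : {set T}) :
  4 * p ^ 3 * d <= #|nbrs adj y| -> indep I ->
  (forall x, x \in I -> bad x y) -> #|I| < 2 * p.
Proof.
move=> big iI Ibad; rewrite ltnNge; apply/negP=> Ip.
have [J JI Jp] : exists2 J : {set T}, J \subset I & #|J| = 2 * p.
  exists [set x in take (2 * p) (enum I)].
    by apply/subsetP=> x; rewrite inE => /mem_take; rewrite mem_enum.
  rewrite cardsE (card_uniqP _) ?take_uniq ?enum_uniq // size_take -cardE.
  by case: ltnP => // h; apply/eqP; rewrite eqn_leq h Ip.
pose N := nbrs adj y; pose t x z := ~~ fwd adj x z : nat.
have cT x : #|[set z in N | ~~ fwd adj x z]| = \sum_(z in N) t x z.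
  by rewrite -sum1dep_card big_mkcondr.
pose S := \sum_(z in N) \sum_(x in J) t x z.
have S1 : 2 * (#|N| + 1) <= S.
  have : \sum_(x in J) (#|N| + 1) <= \sum_(x in J) (\sum_(z in N) t x z) * p.
    by apply: leq_sum => x xJ; rewrite -cT addn1; apply: Ibad (subsetP JI _ xJ).
  rewrite sum_nat_const Jp -big_distrl /= -/S exchange_big /= -/S.
  by rewrite mulnAC leq_pmul2r.
have tt x z : t x z * t x z = t x z by rewrite /t; case: (fwd _ _ _).
have S2 : 3 * S <= 2 * #|N| + (S + (2 * p) * ((2 * p) * d)).
  have -> : S + (2 * p) * ((2 * p) * d) =
      \sum_(x in J) (\sum_(z in N) t x z + (2 * p) * d).
    by rewrite big_split /= sum_nat_const Jp /S exchange_big.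
  (* For integers (T - 1)(T - 2) >= 0, that is, 3T <= 2 + T^2. *)
  apply: (@leq_trans (\sum_(z in N) (2 + (\sum_(x in J) t x z) ^ 2))).
    rewrite /S big_distrr /=; apply: leq_sum => z _; move: (\sum_(x in J) _) => c.
    by clear; rewrite -mulnn; case: c => [|[|c]] //; nia.
  rewrite big_split /= sum_nat_const mulnC leq_add2l.
  under eq_bigr => z _ do rewrite -mulnn big_distrlr.
  rewrite exchange_big; apply: leq_sum => x xJ /=; rewrite exchange_big /=.
  rewrite (bigD1 x) //=; apply: leq_add.
    by apply: leq_sum => z _; rewrite tt.
  apply: (@leq_trans (\sum_(x' in J) d)); last by rewrite sum_nat_const Jp.
  rewrite big_mkcondr /=; apply: leq_sum => x' x'J; case: eqVneq => //= xx'.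
  have nadj : ~~ adj x x' by apply: (indepP _ iI); apply: (subsetP JI).
  rewrite eq_sym in xx'; apply: leq_trans (card_common_nbrs xx' nadj).
  rewrite -sum1dep_card big_mkcond [leqRHS]big_mkcond /=; apply: leq_sum => z _.
  case: (z \in N) => //; rewrite /t /fwd !negb_and !negbK.
  case: (eqVneq z x) => [->|_]; first by rewrite (negbTE xx') adjC (negbTE nadj).
  case: (eqVneq z x') => [->|_]; first by rewrite (negbTE nadj).
  by case: (adj x z); case: (adj x' z).
have h1 : 2 * p * (2 * p * d) <= #|N|.
  apply: leq_trans big; rewrite mulnA leq_mul2r mulnACA (mulnn p) leq_mul2l.
  by rewrite leq_pexp2l // !orbT.
by move: S1 S2 h1; move: (2 * p * _) #|N| => a b; clear; lia.
Qed.

(** Independent sets of bad vertices have fewer than 2p elements, so there are at most (2p)^2 d bad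
    neighbours; the degree threshold is p times that number. *)
Lemma few_bad (y : T) : 4 * p ^ 3 * d <= #|nbrs adj y| ->
  #|[set x in nbrs adj y | bad x y]| * p <= #|nbrs adj y|.
Proof.
move=> big; have [I [iI IB le]] := card_le_indep [set x in nbrs adj y | bad x y].
have Ip : #|I| < 2 * p.
  by apply: indep_bad_lt big iI _ => x /(subsetP IB); rewrite inE => /andP[].
apply: leq_trans big; apply: leq_trans (_ : (2 * p) ^ 2 * d * p <= _).
  rewrite leq_mul2r (leq_trans le) ?orbT // leq_mul2r leq_exp2r //.
  by rewrite (ltnW Ip) orbT.
by rewrite mulnAC expnMn -[2 ^ 2 * _ * _]mulnA -expnSr.
Qed.

(** Below the degree threshold of [few_bad] all neighbours count as dirty, at a cost of fewer than
    4p^3 d edges per vertex. *)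
Definition dirty (x y : T) : bool :=
  (#|nbrs adj y| < 4 * p ^ 3 * d) || bad x y.

Lemma few_dirty (y : T) : #|[set x in nbrs adj y | dirty x y]| * p <=
  p * (4 * p ^ 3 * d) + #|nbrs adj y|.
Proof.
rewrite /dirty; case: ltnP => [lt|ge] /=.
  apply: leq_trans (leq_addr _ _); rewrite mulnC leq_mul2l; apply/orP; right.
  by apply: leq_trans (ltnW lt); apply: subset_leq_card; apply/subsetP=> x; rewrite inE andbT.
exact: leq_trans (few_bad ge) (leq_addl _ _).
Qed.

Lemma card_nbrs (e : rel T) y : #|nbrs e y| = \sum_z e y z.
Proof. by rewrite -sum1dep_card big_mkcond. Qed.

Definition clean (x y : T) : bool := [&& adj x y, ~~ dirty x y & ~~ dirty y x].

Lemma cleanC : symmetric clean.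
Proof. by move=> x y; rewrite /clean adjC [~~ _ && _]andbC. Qed.

Lemma many_clean :
  p * (\sum_x #|nbrs adj x|) <= p * (\sum_x #|nbrs clean x|)
    + 2 * (#|T| * (p * (4 * p ^ 3 * d)) + \sum_x #|nbrs adj x|).
Proof.
pose D := \sum_y \sum_x (adj x y && dirty x y : nat).
have DE : p * D <= #|T| * (p * (4 * p ^ 3 * d)) + \sum_x #|nbrs adj x|.
  have -> : #|T| * (p * (4 * p ^ 3 * d)) = \sum_(y : T) p * (4 * p ^ 3 * d).
    by rewrite sum_nat_const.
  rewrite /D big_distrr -big_split /=; apply: leq_sum => y _.
  apply: leq_trans (few_dirty y); rewrite mulnC leq_mul2r; apply/orP; right.
  rewrite -sum1dep_card [leqRHS]big_mkcond /=; apply: leq_sum => x _.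
  by rewrite inE adjC; case: (_ && _).
suff h : \sum_x #|nbrs adj x| <= \sum_x #|nbrs clean x| + 2 * D.
  by move: h DE; rewrite -(leq_pmul2l p0); nia.
have D2 : D = \sum_x \sum_y (adj x y && dirty x y : nat) by rewrite /D exchange_big.
have -> : 2 * D = D + D by rewrite mul2n addnn.
rewrite {2}D2 -!big_split /=; apply: leq_sum => x _.
rewrite !card_nbrs -!big_split /=; apply: leq_sum => y _.
rewrite /clean (adjC y x).
by case: (adj x y); case: (dirty x y); case: (dirty y x).
Qed.

(* The vertex set U is chosen so that deleting a vertex from it does not pay:
   this keeps the degrees inside U comparable to the original ones while only
   a small proportion of the edges is lost. *)
Lemma regular_subgraph : exists e : rel T,
  [/\ symmetric e, subrel e adj,
      forall x y, e x y ->
        #|[set z in nbrs e y | ~~ fwd adj x z]| * p <= 4 * #|nbrs e y|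
    & p * (\sum_x #|nbrs adj x|) <= p * (\sum_x #|nbrs e x|)
        + 4 * (#|T| * (p * (4 * p ^ 3 * d)) + \sum_x #|nbrs adj x|)].
Proof.
pose g (U : {set T}) := \sum_(x in U) \sum_(y in U) (clean x y : nat).
(* Removing y from U lowers the first term by at most 4 times the clean degree of y inside U and
   adds its full degree to the second. At a maximum the full degree is thus at most 4 times the
   inner one. *)
pose Phi (U : {set T}) := 2 * g U + \sum_(y in ~: U) #|nbrs adj y|.
case: (@arg_maxnP _ [set: T] xpredT Phi isT) => U _ Umax.
exists (fun x y => [&& clean x y, x \in U & y \in U]).
set e := (fun x y => _); have cleanI x : clean x x = false.
  by rewrite /clean adjI.
have eadj : subrel e adj by move=> x y /and3P[/andP[]].
have degU y : y \in U -> #|nbrs e y| = \sum_(z in U) (clean y z : nat).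
  move=> yU; rewrite card_nbrs [RHS]big_mkcond /=; apply: eq_bigr => z _.
  by rewrite /e yU; case: (clean y z); case: (z \in U).
have eU y : y \notin U -> #|nbrs e y| = 0.
  move=> yU; rewrite card_nbrs big1 // => z _.
  by rewrite /e (negbTE yU) andbF.
have gE : g U = \sum_x #|nbrs e x|.
  rewrite /g big_mkcond /=; apply: eq_bigr => x _.
  by case: ifP => [/degU->|/negbT/eU->].
split=> //.
- by move=> x y; rewrite /e cleanC; case: (clean y x) => //=; rewrite andbC.
- move=> x y /and3P[/and3P[_ nxy nyx] xU yU].
  have gD : g U <= g (U :\ y) + 2 * #|nbrs e y|.
    rewrite {1}/g (big_setD1 y) //= degU //.
    have -> : \sum_(x in U :\ y) \sum_(y in U) (clean x y : nat) =
        \sum_(x in U :\ y) (clean x y : nat) + g (U :\ y).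
      rewrite -big_split /=; apply: eq_bigr => z _.
      by rewrite (big_setD1 y).
    have : \sum_(x in U :\ y) (clean x y : nat) <= \sum_(z in U) (clean y z : nat).
      rewrite [leqRHS](big_setD1 y) //= cleanI add0n.
      by apply: leq_sum => z _; rewrite cleanC.
    by lia.
  have deg4 : #|nbrs adj y| <= 4 * #|nbrs e y|.
    have := Umax (U :\ y) isT; rewrite /Phi.
    have -> : \sum_(z in ~: (U :\ y)) #|nbrs adj z| =
        #|nbrs adj y| + \sum_(z in ~: U) #|nbrs adj z|.
      rewrite (big_setD1 y) /= ?inE ?eqxx //; congr (_ + _).
      apply: eq_bigl => z; rewrite !inE; case: eqVneq => [->|] //=.
      by rewrite yU.
    by move: gD; lia.
  apply: leq_trans deg4; move: nxy; rewrite /dirty negb_or /bad -leqNgt => /andP[_].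
  rewrite -leqNgt; apply: leq_trans; rewrite leq_mul2r; apply/orP; right.
  apply: subset_leq_card; apply/subsetP=> z; rewrite !inE => /andP[/eadj-> ->].
  by [].
(* Comparison of U with the whole vertex set: the total loss is at most twice the loss from
   discarding the edges that are not clean. *)
have := Umax [set: T] isT; rewrite /Phi setCT big_set0 addn0 gE.
have -> : g [set: T] = \sum_x #|nbrs clean x|.
  rewrite /g; under eq_bigl => x do rewrite inE.
  by apply: eq_bigr => x _; rewrite card_nbrs; apply: eq_bigl => y; rewrite inE.
have : \sum_x #|nbrs e x| + \sum_(y in ~: U) #|nbrs adj y| <= \sum_x #|nbrs adj x|.
  rewrite [X in _ + X]big_mkcond -big_split /=; apply: leq_sum => x _.
  rewrite inE; case: (boolP (x \in U)) => xU /=.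
    rewrite addn0; apply: subset_leq_card; apply/subsetP=> z.
    by rewrite !inE => /eadj.
  by rewrite eU.
by move: many_clean; nia.
Qed.

End BadNeighbours.

(** * Jensen's inequality for the logarithm, with tilted weights *)

Section Logarithms.
Local Open Scope ring_scope.
Local Arguments ln x%_ring_scope.

Lemma ln_leB1 (x : R) : 0 < x -> ln x <= x - 1.
Proof.
move/RltP=> x0; have /RleP := exp_ineq1_le (ln x).
by rewrite exp_ln // RplusE R1E; lra.
Qed.

Lemma lnM (x y : R) : 0 < x -> 0 < y -> ln (x * y) = ln x + ln y.
Proof. by move=> /RltP x0 /RltP y0; apply: ln_mult. Qed.

Lemma lnV (x : R) : 0 < x -> ln x^-1 = - ln x.
Proof. by move=> /RltP x0; apply: ln_Rinv. Qed.

Lemma ln_le (x y : R) : 0 < x -> x <= y -> ln x <= ln y.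
Proof.
rewrite le_eqVlt => /RltP x0 /predU1P[->//|/RltP xy].
by apply/RleP/Rlt_le/ln_increasing.
Qed.

(** Apply ln t <= t - 1 to t = w(z) / Y, with Y the weighted mean, and sum up. *)
Lemma jensen_ln (I : finType) (A : {set I}) (P w : I -> R) :
  (forall z, z \in A -> 0 < P z) -> (forall z, z \in A -> 0 < w z) ->
  \sum_(z in A) P z = 1 ->
  \sum_(z in A) P z * ln (w z) <= ln (\sum_(z in A) P z * w z).
Proof.
move=> P0 w0 P1; set Y := \sum_(z in A) P z * w z.
have Y0 : 0 < Y.
  have ne : A != set0.
    by apply: contra_eq_neq P1 => ->; rewrite big_set0 eq_sym oner_neq0.
  have [z zA] := set0Pn _ ne; rewrite /Y (big_setD1 z) //=.
  apply: ltr_pwDl; first by rewrite mulr_gt0 ?P0 ?w0.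
  by apply: sumr_ge0 => y /setD1P[_ yA]; rewrite ltW // mulr_gt0 ?P0 ?w0.
have -> : ln Y = \sum_(z in A) P z * ln Y by rewrite -big_distrl /= P1 mul1r.
rewrite -subr_le0 -sumrB.
apply: (@le_trans _ _ (\sum_(z in A) (P z * w z / Y - P z))).
  apply: ler_sum => z zA; rewrite -mulrBr -mulrA -[X in _ <= _ - X]mulr1 -mulrBr.
  rewrite ler_pM2l ?P0 // -lnV // -lnM ?w0 ?invr_gt0 //.
  by rewrite ln_leB1 // divr_gt0 ?w0.
by rewrite sumrB P1 -big_distrl /= divff ?subrr // gt_eqF.
Qed.

(* Jensen's inequality for the weights (1 + s (sg (b z) - mean of sg b)) / #|F|
   instead of uniform ones: the gain s h makes up for a negative mean of b. *)
Lemma tilted_jensen (I : finType) (F : {set I}) (w b : I -> R) (c s h beta : R) :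
  (0 < #|F|)%N -> (forall z, z \in F -> 0 < w z) ->
  (forall z, z \in F -> ln (w z) = c + b z) -> 0 <= s -> s <= 1 / 3 ->
  `|\sum_(z in F) b z| <= beta -> h - beta <= \sum_(z in F) `|b z| ->
  ln (#|F|%:R / (1 + 2 * s)) + c + (s * h - (1 + 2 * s) * beta) / #|F|%:R
    <= ln (\sum_(z in F) w z).
Proof.
move=> F0 w0 wE s0 s3 hB hh; set f : R := #|F|%:R.
have f0 : 0 < f by rewrite ltr0n.
pose sg z := Num.sg (b z); pose mu := (\sum_(z in F) sg z) / f.
have sg1 z : `|sg z| <= 1 by rewrite normr_sg; case: (b z != 0).
have mu1 : `|mu| <= 1.
  rewrite normrM normfV (ger0_norm (ltW f0)) ler_pdivrMr // mul1r.
  apply: le_trans (ler_norm_sum _ _ _) _.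
  apply: (@le_trans _ _ (\sum_(z in F) 1)); first exact: ler_sum.
  by rewrite sumr_const.
pose P z := (1 + s * (sg z - mu)) / f.
have bnd z : `|s * (sg z - mu)| <= 2 * s.
  rewrite normrM (ger0_norm s0) mulrC ler_wpM2r //.
  by apply: le_trans (ler_normB _ _) _; have := sg1 z; move: mu1; lra.
have P0 z : 0 < P z.
  rewrite divr_gt0 //; have := bnd z; rewrite ler_norml; lra.
have Ple z : P z <= (1 + 2 * s) / f.
  rewrite ler_pM2r ?invr_gt0 //; have := bnd z; rewrite ler_norml; lra.
have P1 : \sum_(z in F) P z = 1.
  rewrite -big_distrl /= big_split /= sumr_const -big_distrr /= sumrB sumr_const.
  rewrite -[mu *+ _]mulr_natr -/f /mu divfK ?gt_eqF // subrr mulr0 addr0.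
  by rewrite divff // gt_eqF.
have Pb : \sum_(z in F) P z * ln (w z) = c +
   ((1 - s * mu) * \sum_(z in F) b z + s * \sum_(z in F) `|b z|) / f.
  rewrite (eq_bigr (fun z => P z * c + P z * b z)); last first.
    by move=> z zF; rewrite wE // mulrDr.
  rewrite big_split /= -big_distrl /= P1 mul1r; congr (_ + _).
  rewrite !big_distrr -big_split /= big_distrl /=; apply: eq_bigr => z _.
  by rewrite /P /sg normrEsg; field; rewrite gt_eqF.
have S0 : 0 < \sum_(z in F) P z * w z.
  have /card_gt0P[z zF] := F0; rewrite (big_setD1 z) //=.
  apply: ltr_pwDl; first by rewrite mulr_gt0 ?w0.
  by apply: sumr_ge0 => y /setD1P[_ yF]; rewrite ltW // mulr_gt0 ?w0.
have s1 : 0 < 1 + 2 * s by lra.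
(* No weight exceeds (1 + 2s) / |F|. *)
have lb : f / (1 + 2 * s) * \sum_(z in F) P z * w z <= \sum_(z in F) w z.
  rewrite big_distrr /=; apply: ler_sum => z zF; rewrite mulrA.
  apply: ler_piMl; first by rewrite ltW ?w0.
  by rewrite -ler_pdivlMl ?divr_gt0 // invf_div mulr1.
apply: le_trans (ln_le _ lb); last by rewrite mulr_gt0 // divr_gt0.
rewrite (@lnM (f / (1 + 2 * s))%R) ?divr_gt0 // -addrA lerD2l.
apply: le_trans (jensen_ln (fun z _ => P0 z) w0 P1); rewrite Pb lerD2l.
rewrite ler_pM2r ?invr_gt0 //.
move: hh hB mu1; set B := \sum_(z in F) b z; set H := \sum_(z in F) `|b z|.
rewrite !ler_norml => hh /andP[B1 B2] /andP[m1 m2].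
have beta0 : 0 <= beta by lra.
have q0 : 0 <= 1 - s * mu by nra.
have q1 : 0 <= s * (1 + mu) by rewrite mulr_ge0 //; lra.
have t1 : 0 <= (1 - s * mu) * (B + beta) by rewrite mulr_ge0 //; lra.
have t2 : 0 <= s * (1 + mu) * beta by rewrite mulr_ge0.
have t3 : 0 <= s * (H - (h - beta)) by rewrite mulr_ge0 //; lra.
by nra.
Qed.

End Logarithms.

(** * Capacity of symmetric 0/1 matrices with few zeros *)

Section Capacity.
Local Open Scope ring_scope.
Local Arguments ln x%_ring_scope.

(* A quantitative Sinkhorn-type bound: a symmetric 0/1 matrix with few zeros in
   each row has capacity close to that of the all-ones matrix. *)
Lemma capacity_ge (I : finType) (A : {set I}) (ok : rel I) (w : I -> R) (k : R) :
  symmetric ok -> (0 < #|A|)%N -> 0 <= k -> k <= 1 / 6 ->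
  (forall x, x \in A -> #|[set z in A | ~~ ok x z]|%:R <= k * #|A|%:R) ->
  (forall z, z \in A -> 0 < w z) ->
  #|A|%:R * ln (#|A|%:R / ((1 + 4 * k) / (1 - k))) + \sum_(z in A) ln (w z)
    <= \sum_(x in A) ln (\sum_(z in A | ok x z) w z).
Proof.
move=> okC A0 k0 k6 Abad w0; set m : R := #|A|%:R.
have m0 : 0 < m by rewrite ltr0n.
pose c0 := (\sum_(z in A) ln (w z)) / m; pose b z := ln (w z) - c0.
pose h := \sum_(z in A) `|b z|; pose beta x := \sum_(z in A | ~~ ok x z) `|b z|.
pose F x := [set z in A | ok x z].
have bigF (g : I -> R) x : \sum_(z in F x) g z = \sum_(z in A | ok x z) g z.
  by apply: eq_bigl => z; rewrite inE.
have b0 : \sum_(z in A) b z = 0.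
  by rewrite sumrB sumr_const -[c0 *+ _]mulr_natr divfK ?subrr // gt_eqF.
have FA x : #|F x|%:R + #|[set z in A | ~~ ok x z]|%:R = m :> R.
  rewrite -natrD; congr (_%:R); rewrite -(cardsID [set z | ok x z] A).
  by congr (_ + _)%N; apply: eq_card => z; rewrite !inE // andbC.
have h0 : 0 <= h by apply: sumr_ge0.
have beta0 x : 0 <= beta x by apply: sumr_ge0.
have Fge x : x \in A -> (1 - k) * m <= #|F x|%:R.
  by move=> /Abad; have := FA x; rewrite -/m; lra.
have Fle x : #|F x|%:R <= m by have := FA x; have := ler0n R #|[set z in A | ~~ ok x z]|; lra.
have km0 : 0 < (1 - k) * m by rewrite mulr_gt0 //; lra.
have row x : x \in A -> ln (m / ((1 + 4 * k) / (1 - k))) + c0 +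
   (2 * k * h / m - (1 + 4 * k) / ((1 - k) * m) * beta x)
     <= ln (\sum_(z in A | ok x z) w z).
  move=> xA; have F0 : 0 < #|F x|%:R :> R by apply: lt_le_trans km0 (Fge _ xA).
  have F0n : (0 < #|F x|)%N by rewrite ltr0n in F0.
  (* The tilt 2k yields the total gain 2k h. The total loss is at most (1 + 4k) / (1 - k) times k h,
     and the first factor is at most 2 because k <= 1/6. *)
  pose s := 2 * k.
  rewrite -bigF; apply: le_trans (@tilted_jensen _ _ _ b c0 s h (beta x) F0n _ _ _ _ _ _).
  - rewrite /s -!addrA lerD //.
      apply: ln_le; first by apply: divr_gt0 => //; apply: divr_gt0; lra.
      rewrite (_ : 2 * (2 * k) = 4 * k); last by ring.
      rewrite invf_div mulrA ler_pM2r ?invr_gt0; last by lra.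
      by rewrite mulrC Fge.
    rewrite lerD2l (_ : 1 + 2 * (2 * k) = 1 + 4 * k); last by ring.
    rewrite [leRHS]mulrBl lerB //.
      apply: ler_wpM2l; first by rewrite !mulr_ge0.
      by rewrite lef_pV2 ?Fle // posrE.
    rewrite mulrAC; apply: ler_wpM2r => //; apply: ler_wpM2l; first lra.
    by rewrite lef_pV2 ?Fge // posrE.
  - by move=> z; rewrite inE => /andP[/w0].
  - by move=> z _; rewrite /b addrC subrK.
  - by rewrite mulr_ge0.
  - by rewrite /s; lra.
  - rewrite bigF.
    have -> : \sum_(z in A | ok x z) b z = - \sum_(z in A | ~~ ok x z) b z.
      by apply/eqP; rewrite -addr_eq0 -bigID /= b0.
    by rewrite normrN ler_norm_sum.
  - by rewrite bigF /h (bigID (ok x)) /= -/(beta x) addrK.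
apply: (@le_trans _ _ (\sum_(x in A) (ln (m / ((1 + 4 * k) / (1 - k))) + c0 +
   (2 * k * h / m - (1 + 4 * k) / ((1 - k) * m) * beta x)))); last exact: ler_sum.
have cst (y : R) : \sum_(x in A) y = m * y by rewrite sumr_const -mulr_natl.
have cE : m * c0 = \sum_(z in A) ln (w z) by rewrite mulrC divfK // gt_eqF.
rewrite big_split big_split sumrB /= !cst cE -big_distrr /= lerDl.
have -> : m * (2 * k * h / m) = 2 * k * h by rewrite mulrC divfK // gt_eqF.
(* By symmetry each |b z| occurs in [beta x] for at most k m rows [x]. *)
have Sb : \sum_(x in A) beta x <= k * m * h.
  rewrite /beta (exchange_big_dep (mem A)) /=; last by move=> x z _ /andP[].
  rewrite /h big_distrr /=; apply: ler_sum => z zA.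
  rewrite (eq_bigl (mem [set x in A | ~~ ok z x])); last first.
    by move=> x; rewrite !inE zA okC.
  by rewrite sumr_const -mulr_natl ler_wpM2r // Abad.
rewrite subr_ge0; apply: (@le_trans _ _ ((1 + 4 * k) / ((1 - k) * m) * (k * m * h))).
  by rewrite ler_wpM2l // divr_ge0 ?ltW //; lra.
have -> : (1 + 4 * k) / ((1 - k) * m) * (k * m * h) = (1 + 4 * k) / (1 - k) * (k * h).
  by field; rewrite !gt_eqF //; lra.
rewrite -[leRHS]mulrA ler_wpM2r ?mulr_ge0 // ler_pdivrMr; lra.
Qed.

End Capacity.

(** * Growth of the mean logarithm of the number of good walks *)

Section WalkCount.
Variables (T : finType) (adj e : rel T) (p : nat).
Hypotheses (adjC : symmetric adj) (eC : symmetric e) (p24 : (24 <= p)%N).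
Hypothesis few : forall x y, e x y ->
  (#|[set z in nbrs e y | ~~ fwd adj x z]| * p <= 4 * #|nbrs e y|)%N.
Local Open Scope ring_scope.
Local Arguments ln x%_ring_scope.

Let n : R := #|T|%:R.
Let N : R := (\sum_y #|nbrs e y|)%N%:R.
Let kp : R := (4 / p%:R)%R.
Let c : R := ((1 + 4 * kp) / (1 - kp))%R.

Lemma nwalk_gt0 k x y : e x y -> (0 < nwalk adj e k x y)%N.
Proof.
elim: k x y => //= k IH x y xy.
have [z yz xz] : exists2 z, e y z & fwd adj x z.
  have y0 : (0 < #|nbrs e y|)%N by apply/card_gt0P; exists x; rewrite inE eC.
  have /existsP[z /andP[]] : [exists z, e y z && fwd adj x z]; last by exists z.
  apply: contraT => /existsPn none; have := few xy.
  have -> : [set z in nbrs e y | ~~ fwd adj x z] = nbrs e y.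
    by apply/setP=> z; have := none z; rewrite !inE; case: (e y z).
  by rewrite mulnC leq_pmul2r // leqNgt (leq_trans _ p24).
by rewrite (bigD1 z) ?yz ?xz //= addn_gt0 IH.
Qed.

Definition log_walks k : R := \sum_y \sum_(x in nbrs e y) ln (nwalk adj e k x y)%:R.

Lemma exchange_nbrs (g : T -> T -> R) :
  \sum_y \sum_(x in nbrs e y) g x y = \sum_y \sum_(x in nbrs e y) g y x.
Proof.
rewrite (exchange_big_dep xpredT) //=; apply: eq_bigr => y _.
by apply: eq_bigl => x; rewrite !inE eC.
Qed.

(** The range in which [capacity_ge] applies; it is the source of the bound 24 <= p. *)
Lemma kp_bounds : (0 < kp) * (kp <= 1 / 6).
Proof.
have := p24; rewrite -(ler_nat R) => p0.
have p1 : 0 < p%:R :> R by rewrite ltr0n (leq_trans _ p24).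
by split; rewrite /kp; [rewrite divr_gt0 | rewrite ler_pdivrMr //; lra].
Qed.

Lemma c_gt0 : 0 < c.
Proof. by have [k0 k1] := kp_bounds; rewrite /c divr_gt0 //; lra. Qed.

(** Reverse the edges on the left by [exchange_nbrs], then apply [capacity_ge] at each [y] to the
    numbers of walks continuing the edges from [y] to its neighbours. *)
Lemma log_walks_step k :
  \sum_y #|nbrs e y|%:R * ln (#|nbrs e y|%:R / c) + log_walks k <= log_walks k.+1.
Proof.
rewrite /log_walks exchange_nbrs -big_split /=; apply: ler_sum => y _.
have [y0|y0] := posnP #|nbrs e y|.
  by rewrite (cards0_eq y0) !big_set0 cards0 mul0r addr0.
have [k0 k1] := kp_bounds.
apply: le_trans (@capacity_ge _ (nbrs e y) (fwd adj)
  (fun z => (nwalk adj e k y z)%:R) kp (fwdC adjC) y0 (ltW k0) k1 _ _) _.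
- move=> x; rewrite inE eC => /few h; rewrite /kp mulrAC ler_pdivlMr.
    by rewrite -!natrM ler_nat.
  by rewrite ltr0n (leq_trans _ p24).
- by move=> z; rewrite inE ltr0n; apply: nwalk_gt0.
apply: ler_sum => x _; rewrite natr_sum.
by under [X in _ <= ln X]eq_bigl => z do rewrite -[e y z]inE.
Qed.

Lemma sum_deg_ln : 0 < N ->
  N * ln (N / (c * n)) <= \sum_y #|nbrs e y|%:R * ln (#|nbrs e y|%:R / c).
Proof.
move=> N0; have c0 := c_gt0.
have n0 : 0 < n.
  rewrite ltr0n; apply: contraTT N0; rewrite -eqn0Ngt => /eqP/card0_eq T0.
  by rewrite /N big_pred0 ?ltxx // => y; have := T0 y.
have NE : N = \sum_y #|nbrs e y|%:R by rewrite /N natr_sum.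
rewrite -subr_ge0 {1}NE big_distrl -sumrB /=.
apply: (@le_trans _ _ (\sum_y (#|nbrs e y|%:R - N / n))).
  rewrite sumrB -NE sumr_const -mulr_natl mulrC -/n.
  by rewrite (_ : N / n * n = N) ?subrr // divfK // gt_eqF.
apply: ler_sum => y _; have [->|y0] := posnP #|nbrs e y|.
  by rewrite !mul0r !sub0r oppr0 oppr_le0 divr_ge0 ?ltW.
set u : R := #|nbrs e y|%:R; have u0 : 0 < u by rewrite ltr0n.
rewrite -mulrBr -[X in X - _](mulfK (lt0r_neq0 u0)) -[X in X - _]mulrA.
have -> : u * (u / u) - N / n = u * (1 - N / (n * u)).
  by field; rewrite !gt_eqF.
rewrite ler_pM2l //.
have t0 : 0 < N / (n * u) by rewrite divr_gt0 // mulr_gt0.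
have -> : N / (c * n) = N / (n * u) * (u / c) by field; rewrite !gt_eqF.
have uc : 0 < u / c by apply: divr_gt0.
rewrite (lnM t0 uc) opprD addrCA subrr addr0 lerNr opprB.
exact: ln_leB1.
Qed.

Lemma log_walks_ge k : 0 < N -> N * (k%:R * ln (N / (c * n))) <= log_walks k.
Proof.
move=> N0; elim: k => [|k IH].
  rewrite mul0r mulr0 /log_walks big1 // => y _.
  by rewrite big1 // => x _; rewrite /= ln_1.
apply: le_trans (log_walks_step k); apply: le_trans (lerD (sum_deg_ln N0) IH).
by rewrite -mulrDr -natr1 mulrDl mul1r addrC.
Qed.

Lemma walk_count_le (k : nat) (X : R) : 0 < N ->
  (forall x y, e x y -> (nwalk adj e k x y)%:R <= X) ->
  k%:R * ln (N / (c * n)) <= ln X.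
Proof.
move=> N0 leX; rewrite -(ler_pM2l N0); apply: le_trans (log_walks_ge k N0) _.
rewrite /N natr_sum big_distrl; apply: ler_sum => y _ /=.
rewrite -sum1_card natr_sum big_distrl /=; apply: ler_sum => x.
rewrite inE eC => xy; rewrite mul1r; apply: ln_le; last exact: leX.
by rewrite ltr0n nwalk_gt0.
Qed.

(** Pair the two orientations of each edge: counts with a + b <= X satisfy ab <= (X/2)^2. *)
Lemma walk_count_add_le (k : nat) (X : R) : 0 < N ->
  (forall x y, e x y -> (nwalk adj e k x y)%:R + (nwalk adj e k y x)%:R <= X) ->
  k%:R * ln (N / (c * n)) <= ln (X / 2).
Proof.
move=> N0 leX; rewrite -(ler_pM2l N0); apply: le_trans (log_walks_ge k N0) _.
have E : log_walks k + log_walks k = \sum_y \sum_(x in nbrs e y)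
    (ln (nwalk adj e k x y)%:R + ln (nwalk adj e k y x)%:R).
  rewrite /log_walks {2}exchange_nbrs -big_split; apply: eq_bigr => y _.
  by rewrite big_split.
suff : log_walks k + log_walks k <= N * ln (X / 2) + N * ln (X / 2) by lra.
rewrite E -mulrDr /N natr_sum big_distrl; apply: ler_sum => y _ /=.
rewrite -sum1_card natr_sum big_distrl /=; apply: ler_sum => x.
rewrite inE eC mul1r => xy; have yx : e y x by rewrite eC.
have := leX _ _ xy; have := nwalk_gt0 k xy; have := nwalk_gt0 k yx.
rewrite -!(ltr0n R); move: (_%:R) (_%:R) => a b a0 b0 ab.
rewrite -!lnM //; [|lra..]; apply: ln_le; first by rewrite mulr_gt0.
have h1 : 0 <= (a - b) * (a - b) by rewrite -expr2 sqr_ge0.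
have h2 : 0 <= (X - (a + b)) * (X + (a + b)) by rewrite mulr_ge0 //; lra.
by lra.
Qed.

End WalkCount.

(** * From walk counts to the number of edges *)

Lemma f1_le_sum_degrees (V : finType) (G : {set {set V}}) :
  2 * f1 G <= \sum_y #|nbrs (is_edge G) y|.
Proof.
pose S := [set F in G | #|F| == 2]; pose P := [set q : V * V | is_edge G q.1 q.2].
have -> : \sum_y #|nbrs (is_edge G) y| = #|P|.
  under eq_bigr => y _ do rewrite card_nbrs.
  by rewrite pair_bigA -sum1dep_card [RHS]big_mkcond.
have PS q : q \in P -> [set q.1; q.2] \in S.
  by rewrite !inE /is_edge cards2 => /andP[-> ->].
rewrite -[#|P|]sum1_card (partition_big (fun q => [set q.1; q.2]) (mem S)) //=.
rewrite mulnC -sum_nat_const; apply: leq_sum => F.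
rewrite inE => /andP[FG /cards2P[a [b [ab EF]]]].
rewrite sum1_card -[2]/(true.+1) -ab.
have <- : #|[set (a, b); (b, a)]| = (a != b).+1.
  by rewrite cards2 xpair_eqE (eq_sym b) andbb.
apply: subset_leq_card; apply/subsetP=> q; rewrite !inE.
have abG : [set a; b] \in G by rewrite -EF.
case/orP=> /eqP-> /=; rewrite unfold_in /= inE /is_edge EF.
  by rewrite ab abG eqxx.
by rewrite eq_sym ab setUC abG eqxx.
Qed.

(** Cliques of size at least 2 are faces. A single element of [V] need not be a face, hence the
    hypothesis [1 <= dimp1 G]. *)
Lemma dim_clique_le (V : finType) (k : fieldType) (G : {set {set V}}) (m : nat) :
  is_complex G -> girth_gt k G 1 m -> 3 <= m -> 1 <= dimp1 G ->
  clique_le (is_edge G) (dimp1 G).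
Proof.
move=> Gc Gm m3 d1 C cl; have [C1|C2] := leqP #|C| 1; first exact: leq_trans d1.
exact: (leq_bigmax_cond _ (clique_face Gc Gm m3 C2 cl)).
Qed.

Section EdgeBound.
Variables (T : finType) (adj : rel T) (m d p k : nat).
Hypotheses (adjC : symmetric adj) (adjI : irreflexive adj).
Hypotheses (Hcyc : no_short_induced_cycle adj m) (Hcl : clique_le adj d).
Hypotheses (m4 : 4 <= m) (p24 : 24 <= p).
Local Open Scope ring_scope.
Local Arguments ln x%_ring_scope.
Local Arguments exp x%_ring_scope.

Let n : R := #|T|%:R.
Let N0 : R := (\sum_y #|nbrs adj y|)%N%:R.
Let X : R := (n * (d.-1)%:R ^+ k)%R.
Let c : R := ((1 + 4 * (4 / p%:R)) / (1 - 4 / p%:R))%R.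

(** Passing to the subgraph costs at most 4 N0 + 16 p^4 n d out of p N0, which is at most 5 N0 by
    the lower bound on N0. [Y] stands for the bound on walks with k + 1 steps. *)
Lemma edge_bound_of (Y : R) : 16 * p%:R ^+ 4 * n * d%:R < N0 -> 0 < n ->
  (forall e : rel T, symmetric e -> subrel e adj ->
     (forall x y, e x y ->
        (#|[set z in nbrs e y | ~~ fwd adj x z]| * p <= 4 * #|nbrs e y|)%N) ->
     0 < (\sum_y #|nbrs e y|)%N%:R :> R ->
     k.+1%:R * ln ((\sum_y #|nbrs e y|)%N%:R / (c * n)) <= ln Y) ->
  (p%:R - 5) * N0 <= p%:R * (c * n * exp (ln Y / k.+1%:R)).
Proof.
move=> N0big n0 HY.
have p0 : (0 < p)%N by apply: leq_trans p24.
have p1 : 0 < p%:R :> R by rewrite ltr0n.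
have [e [eC eadj few]] := regular_subgraph adjC adjI Hcyc Hcl m4 p0.
rewrite -(ler_nat R) !(natrD, natrM, natrX).
set N : R := (\sum_y #|nbrs e y|)%N%:R; rewrite -/n -/N0 => sub.
have h1 : (p%:R - 5) * N0 <= p%:R * N.
  move: sub N0big; rewrite -/n.
  have -> : 4 * (n * (p%:R * (4 * p%:R ^+ 3 * d%:R)) + N0)
     = 16 * p%:R ^+ 4 * n * d%:R + 4 * N0 by ring.
  by move: (16 * _ * _ * _) => A; lra.
have N00 : 0 < N0 by apply: le_lt_trans N0big; rewrite !mulr_ge0 ?exprn_ge0 ?ler0n.
have : (5 < p)%N by rewrite (leq_trans _ p24).
rewrite -(ltr_nat R) => p5.
have Npos : 0 < N.
  rewrite -(pmulr_rgt0 _ p1); apply: lt_le_trans h1.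
  by rewrite mulr_gt0 // subr_gt0.
have cpos : 0 < c := c_gt0 p24.
have := HY e eC eadj few Npos; rewrite -/N => h2.
have cn0 : 0 < c * n by apply: mulr_gt0.
apply: le_trans h1 _; rewrite ler_pM2l // mulrC -ler_pdivrMr //.
have q0 : 0 < N / (c * n) by apply: divr_gt0.
have <- : exp (ln (N / (c * n))) = N / (c * n) by apply: exp_ln; apply/RltP.
have h3 : ln (N / (c * n)) <= ln Y / k.+1%:R.
  by rewrite ler_pdivlMr ?ltr0n // mulrC.
move: h3; rewrite le_eqVlt => /predU1P[->//|/RltP h3].
by apply/RleP/Rlt_le/exp_increasing.
Qed.

Lemma even_edge_bound : (2 * k.+1 <= m)%N -> 0 < n ->
  16 * p%:R ^+ 4 * n * d%:R < N0 ->
  (p%:R - 5) * N0 <= p%:R * (c * n * exp (ln X / k.+1%:R)).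
Proof.
move=> km n0 big; apply: edge_bound_of => // e eC eadj few Npos.
apply: (walk_count_le adjC eC p24 few Npos) => x y /eadj xy.
rewrite /X /n -natrX -natrM ler_nat.
exact: (nwalk_le adjC adjI Hcyc Hcl eadj).
Qed.

Lemma odd_edge_bound : (2 * k.+1 + 1 <= m)%N -> 0 < n ->
  16 * p%:R ^+ 4 * n * d%:R < N0 ->
  (p%:R - 5) * N0 <= p%:R * (c * n * exp (ln (X / 2) / k.+1%:R)).
Proof.
move=> km n0 big; apply: edge_bound_of => // e eC eadj few Npos.
apply: (walk_count_add_le adjC eC p24 few Npos) => x y /eadj xy.
rewrite /X /n -natrX -natrM -natrD ler_nat.
exact: (nwalk_add_le adjC adjI Hcyc Hcl eadj).
Qed.

End EdgeBound.

(** * Estimates for D^(1 - 1/r) n^(1 + 1/r) *)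

Section RealEstimates.
Local Open Scope ring_scope.
Local Arguments ln x%_ring_scope.
Local Arguments exp x%_ring_scope.
Local Arguments Rpower (x y)%_ring_scope.

Lemma lnXn (x : R) (k : nat) : 0 < x -> ln (x ^+ k) = k%:R * ln x.
Proof.
move=> x0; elim: k => [|k IH]; first by rewrite expr0 mul0r; apply: ln_1.
by rewrite exprS lnM ?exprn_gt0 // IH -natr1 mulrDl mul1r addrC.
Qed.

Lemma exp_lnK (x : R) : 0 < x -> exp (ln x) = x.
Proof. by move/RltP/exp_ln. Qed.

Lemma exp_le (x y : R) : x <= y -> exp x <= exp y.
Proof.
rewrite le_eqVlt => /predU1P[->//|/RltP xy].
by apply/RleP/Rlt_le/exp_increasing.
Qed.

Lemma expR_gt0 (x : R) : 0 < exp x.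
Proof. by apply/RltP/exp_pos. Qed.

Variables (n D : R) (k : nat).
Hypotheses (n0 : 0 < n) (D0 : 0 < D).
Let r : R := (k.+1%:R)%R.
Let A : R := (Rpower D (1 - r^-1) * Rpower n (1 + r^-1))%R.

Let r0 : 0 < r. Proof. by rewrite ltr0n. Qed.

Lemma moore_product : n * exp (ln (n * D ^+ k) / r) = A.
Proof.
rewrite /A /Rpower -[n in LHS]exp_lnK // !expRD; congr exp.
rewrite exp_lnK // lnM ?exprn_gt0 // lnXn //.
have -> : k%:R = (r - 1)%R by rewrite /r -natr1 addrK.
by rewrite !(RplusE, RmultE); field; rewrite nat1r pnatr_eq0.
Qed.

Lemma moore_product_half :
  n * exp (ln (n * D ^+ k / 2) / r) = A * Rpower 2 (- r^-1).
Proof.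
rewrite -moore_product -[RHS]mulrA /Rpower expRD; congr (_ * exp _).
rewrite (@lnM (n * D ^+ k)%R) ?mulr_gt0 ?exprn_gt0 ?invr_gt0 // lnV //.
by rewrite !(RplusE, RmultE); field; rewrite nat1r pnatr_eq0.
Qed.

(** Here A = n D (n/D)^(1/r), and (n/D)^(1/r) >= exp B >= B. The smallness of r / ln(n/d) enters
    through this estimate. *)
Lemma moore_product_ge (B : R) : r * B <= ln (n / D) -> B * n * D <= A.
Proof.
move=> hB.
have -> : A = exp (ln (n / D) / r) * n * D.
  rewrite -[in X in _ * X](exp_lnK D0) -[in X in _ * X * _](exp_lnK n0).
  rewrite /A /Rpower !expRD; congr exp; rewrite lnM ?invr_gt0 // lnV //.
  by rewrite !(RplusE, RmultE); field; rewrite nat1r pnatr_eq0.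
rewrite ler_pM2r // ler_pM2r //.
apply: (@le_trans _ _ (exp B)).
  have /RleP := exp_ineq1_le B; rewrite RplusE R1E; lra.
by apply: exp_le; rewrite ler_pdivlMr // mulrC.
Qed.

End RealEstimates.

(** * Bookkeeping of the constants *)

Section Conclusion.
Local Open Scope ring_scope.

(** The left side exceeds p - 5 by 25 + 80/(p - 4), while 2 eps (p - 5) is at least 80 (p - 5)/p. *)
Lemma sharp_constant (eps p : R) : 30 <= p -> 40 <= p * eps ->
  p * ((1 + 4 * (4 / p)) / (1 - 4 / p)) <= (1 + 2 * eps) * (p - 5).
Proof.
move=> p30 pe.
have p0 : 0 < p by lra.
have -> : p * ((1 + 4 * (4 / p)) / (1 - 4 / p)) = p * (p + 16) / (p - 4).
  by field; rewrite gt_eqF //= ?gt_eqF //; lra.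
rewrite ler_pdivrMr; last by lra.
have e0 : 0 < eps by rewrite -(pmulr_rgt0 _ p0); lra.
have h1 : 0 <= (p * eps - 40) * (p - 9) by rewrite mulr_ge0 //; lra.
nra.
Qed.

(* In the first alternative the number of edges is so small that the crude
   estimate A >= 64 p^4 n (d - 1) suffices. *)
Lemma combine_bounds (eps p f n d c A E N coef q : R) :
  30 <= p -> 40 <= p * eps -> 0 < n -> 2 <= d ->
  64 * p ^+ 4 * n * (d - 1) <= A -> 2 * f <= N ->
  c = (1 + 4 * (4 / p)) / (1 - 4 / p) ->
  n * E = A * q -> 0 <= q -> q <= 1 -> 1 / 4 <= coef -> q / 2 + eps <= coef ->
  (16 * p ^+ 4 * n * d < N -> (p - 5) * N <= p * (c * n * E)) -> f <= coef * A.
Proof.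
move=> p30 pe n0 d2 Abig fN cE nE q0 q1 co1 co2 H.
have p4 : 0 < p ^+ 4 by rewrite exprn_gt0 //; lra.
have pn : 0 < p ^+ 4 * n by rewrite mulr_gt0.
have A0 : 0 <= A.
  by apply: le_trans Abig; rewrite -mulrA mulr_ge0 ?mulr_ge0 //; lra.
(* If N is small, 2f <= 16 p^4 n d <= 32 p^4 n (d - 1) <= A/2 since d >= 2; hence the factor 64 and
   the bound 1/4. *)
have [small|big] := leP N (16 * p ^+ 4 * n * d).
  have h1 : 0 <= p ^+ 4 * n * (d - 2) by rewrite mulr_ge0 //; lra.
  have h2 : 0 <= (coef - 1 / 4) * A by rewrite mulr_ge0 //; lra.
  by nra.
have e0 : 0 < eps by nra.
have := H big; rewrite -mulrA nE mulrA.
have := sharp_constant p30 pe; rewrite -cE => sc hN.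
have p5 : 0 < p - 5 by lra.
have Aq : 0 <= A * q by rewrite mulr_ge0.
have h3 : N <= (1 + 2 * eps) * (A * q).
  by rewrite -(ler_pM2l p5); have := ler_wpM2r Aq sc; lra.
have h4 : 0 <= A * (1 - q) by rewrite mulr_ge0 //; lra.
have h5 : 0 <= eps * (A * (1 - q)) by rewrite mulr_ge0 //; lra.
have h6 : 0 <= A * (coef - (q / 2 + eps)) by rewrite mulr_ge0 //; lra.
by nra.
Qed.
End Conclusion.

(** * Assembly of the even and odd cases *)

Section Assembly.
Local Open Scope ring_scope.
Local Arguments ln x%_ring_scope.
Local Arguments exp x%_ring_scope.
Local Arguments Rpower (x y)%_ring_scope.
Local Arguments rpow (x y)%_ring_scope.

Lemma rpow_pos (x y : R) : 0 < x -> rpow x y = Rpower x y.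
Proof.
move=> x0; rewrite /rpow; case: RIneq.Req_EM_T => // x00.
by rewrite x00 ltxx in x0.
Qed.

Lemma rpow_ge0 (x y : R) : 0 <= rpow x y.
Proof.
by rewrite /rpow; destruct (RIneq.Req_EM_T x _); rewrite ?lexx // ltW // expR_gt0.
Qed.

Variables (V : finType) (G : {set {set V}}) (p r : nat) (eps : R).
Hypotheses (p30 : (30 <= p)%N) (pe : 40%:R <= p%:R * eps).

Let n : R := #|V|%:R.
Let d : R := (dimp1 G)%:R.
Let N : R := (\sum_y #|nbrs (is_edge G) y|)%N%:R.
Let c : R := ((1 + 4 * (4 / p%:R)) / (1 - 4 / p%:R))%R.
Let A : R :=
  (rpow (d - 1) (1 - r.+1%:R^-1) * Rpower n (1 + r.+1%:R^-1))%R.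

Hypothesis nd : r.+1%:R * (64 * p%:R ^+ 4) <= ln (n / d).

Lemma edges_le (coef q E : R) :
  (0 < n -> 0 < d - 1 -> n * E = A * q) -> 0 <= q -> q <= 1 ->
  1 / 4 <= coef -> q / 2 + eps <= coef ->
  (0 < n -> 16 * p%:R ^+ 4 * n * d < N ->
     (p%:R - 5) * N <= p%:R * (c * n * E)) ->
  (f1 G)%:R <= coef * A.
Proof.
move=> nE q0 q1 co1 co2 H.
have fN : 2 * (f1 G)%:R <= N.
  by rewrite -natrM ler_nat; apply: f1_le_sum_degrees.
(* Without edges the claim is non-negativity. An edge forces d >= 2, so the base d - 1 is positive
   and [rpow] agrees with [Rpower]. *)
have [f0|fpos] : f1 G = 0%N \/ (0 < f1 G)%N by case: posnP; [left | right].
  rewrite f0 mulr_ge0 //; first by lra.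
  by rewrite mulr_ge0 ?rpow_ge0 // ltW // expR_gt0.
have [F] : exists F, F \in [set F in G | #|F| == 2] by apply/card_gt0P.
rewrite inE => /andP[FG F2].
have d2n : (2 <= dimp1 G)%N by apply: leq_trans (leq_bigmax_cond _ FG); rewrite (eqP F2).
have := d2n; rewrite -(ler_nat R) -/d => d2.
have n0 : 0 < n.
  rewrite ltr0n; apply: leq_trans (max_card (mem F)).
  by rewrite (eqP F2).
have d10 : 0 < d - 1 by lra.
have p30' := p30; rewrite -(ler_nat R) in p30'.
apply: (@combine_bounds eps p%:R _ n d c A E N coef q) => //.
- rewrite /A rpow_pos //.
  apply: moore_product_ge => //; apply: le_trans nd _; apply: ln_le.
    by rewrite divr_gt0 //; lra.
  by rewrite ler_pM2l // lef_pV2 ?posrE //; lra.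
- exact: nE.
- exact: H.
Qed.

End Assembly.

Open Scope R_scope.

Theorem mainTheorem2 (k : fieldType) (eps : R) :
  0 < eps ->
  exists delta : R, 0 < delta /\
    forall (V : finType) (G : {set {set V}}) (r d : nat),
      is_complex G ->
      (2 <= r)%nat ->
      d = dimp1 G ->
      (1 <= d)%nat ->
      0 < ln (INR #|V| / INR d) ->
      INR r / ln (INR #|V| / INR d) < delta ->
      (girth_gt k G 1 (2 * r)%nat ->
         INR (f1 G) <= (/ 2 + eps) * rpow (INR d - 1) (1 - / INR r)
                         * Rpower (INR #|V|) (1 + / INR r))
      /\
      (girth_gt k G 1 (2 * r + 1)%nat ->
         INR (f1 G) <= (Rpower 2 (- 1 - / INR r) + eps)
                         * rpow (INR d - 1) (1 - / INR r)
                         * Rpower (INR #|V|) (1 + / INR r)).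
Proof.
Local Close Scope R_scope.
Local Open Scope ring_scope.
move=> /RltP eps0.
(* One integer p controls all error terms; its two lower bounds are those of [sharp_constant]. *)
have [p p30 pe] : exists2 p : nat, (30 <= p)%N & 40%:R <= p%:R * eps.
  exists (maxn 30 (Num.bound (40%:R / eps))); first exact: leq_maxl.
  rewrite -ler_pdivrMr //.
  have e1 : 0 <= 40%:R / eps by rewrite divr_ge0 // ltW.
  apply: ltW; apply: lt_le_trans (archi_boundP e1) _.
  by rewrite ler_nat leq_maxr.
have p24 : (24 <= p)%N by apply: leq_trans p30.
(* With delta = 1/B the hypothesis gives r B <= ln(n/d); B is the factor that [combine_bounds] asks
   for. *)
pose B : R := (64 * p%:R ^+ 4)%R.
have B0 : 0 < B by rewrite mulr_gt0 ?exprn_gt0 // ltr0n (leq_trans _ p24).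
exists B^-1; split; first by apply/RltP; rewrite invr_gt0.
move=> V G r d Gc r2 dE d1 /RltP L0 /RltP.
(* From here on [r.+1] is the r of the statement, and [r] is the exponent of d - 1 in the walk
   bound. *)
case: r r2 => // r r1; rewrite dE in d1 L0 *; rewrite !INRE in L0 *.
set L := ln _ in L0 *; move=> hd.
have nd : r.+1%:R * B <= ln (#|V|%:R / (dimp1 G)%:R)%R.
  move: hd; rewrite RdivE.
  by rewrite ltr_pdivrMr // ltr_pdivlMl // mulrC => /ltW.
have adjC := complex_edgeC G.
have adjI : irreflexive (is_edge G) by move=> x; rewrite /is_edge eqxx.
have e0 : 0 <= eps := ltW eps0.
have nat_pred : (dimp1 G).-1%:R = ((dimp1 G)%:R - 1 : R)%R.
  by apply: (addIr 1); rewrite subrK natr1 prednK.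
split=> Gm; rewrite Rmult_assoc; apply/RleP.
  have m4 : (4 <= 2 * r.+1)%N by lia.
  have Hcl := dim_clique_le Gc Gm (ltnW m4) d1.
  set coef := Rplus _ eps; have coefE : coef = (2^-1 + eps)%R by [].
  suff : (f1 G)%:R <= coef * (rpow ((dimp1 G)%:R - 1)%R (1 - r.+1%:R^-1)%R
     * Rpower #|V|%:R (1 + r.+1%:R^-1)%R) by [].
  apply: (@edges_le V G p r eps p30 pe nd _ (1%R)
    (exp (ln (#|V|%:R * (dimp1 G).-1%:R ^+ r)%R / r.+1%:R)%R)) => //.
  - by move=> n0 D0; rewrite mulr1 nat_pred rpow_pos //; apply: moore_product.
  - by rewrite coefE; lra.
  - by rewrite coefE; lra.
  by move=> n0; apply: (even_edge_bound adjC adjI (no_short_cycle Gc Gm) Hcl).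
have m4 : (4 <= 2 * r.+1 + 1)%N by lia.
have Hcl := dim_clique_le Gc Gm (ltnW m4) d1.
(* The root of degree [r.+1] of the factor 1/2 saved in the walk count. It lies between 1/2 and 1,
   so the coefficient is at least 1/4. *)
pose q := Rpower 2%:R%R (- r.+1%:R^-1)%R.
have r0 : 0 < r.+1%:R^-1 :> R by rewrite invr_gt0 ltr0n.
have rr1 : r.+1%:R^-1 <= 1 :> R by rewrite invf_le1 ?ltr0n // ler1n.
have ln2 : 0 <= ln 2%:R%R.
  have <- : ln 1%R = 0 := ln_1.
  by apply: ln_le; rewrite ?ltr01 // ler1n.
have e2 : 2%:R^-1 = exp (- ln 2%:R)%R by rewrite -lnV ?exp_lnK ?invr_gt0 ?ltr0n.
have q1 : q <= 1.
  have <- : exp 0%R = 1 := exp_0.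
  by apply: exp_le; rewrite RmultE mulNr oppr_le0 mulr_ge0 // ltW.
set coef := Rplus _ eps.
have coefE : coef = (q / 2 + eps)%R.
  have two : IZR 2 = 2%:R by [].
  rewrite /coef RplusE two; congr (_ + _); rewrite /q /Rpower e2 expRD; congr exp.
  rewrite !RmultE RminusE; have -> : IZR (-1) = -1 by [].
  by rewrite ?RinvE mulrBl mulN1r mulNr addrC.
have q2 : 2%:R^-1 <= q.
  by rewrite e2; apply: exp_le; rewrite RmultE mulNr lerN2 ler_piMl.
suff : (f1 G)%:R <= coef * (rpow ((dimp1 G)%:R - 1)%R (1 - r.+1%:R^-1)%R
     * Rpower #|V|%:R (1 + r.+1%:R^-1)%R) by [].
apply: (@edges_le V G p r eps p30 pe nd _ q
    (exp (ln (#|V|%:R * (dimp1 G).-1%:R ^+ r / 2)%R / r.+1%:R)%R)) => //.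
- by move=> n0 D0; rewrite nat_pred rpow_pos //; apply: moore_product_half.
- by rewrite ltW // expR_gt0.
- by rewrite coefE; lra.
- by rewrite coefE.
by move=> n0; apply: (odd_edge_bound adjC adjI (no_short_cycle Gc Gm) Hcl).
Qed.
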